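(* Let $X$ be a nonzero finite-dimensional real vector space with a norm $\|\cdot\|_0$, and let $f:X\to\mathbb{R}$ be finite and convex. Assume $p\in\operatorname{dom} f^*\setminus\operatorname{ran}\partial f$ and let $(z_k)$ be a sequence in $X$ satisfying $$f(z_k)-p(z_k)\longrightarrow -f^*(p).$$ Then $\|z_k\|_0\to\infty$. Every cluster point $u$ of $z_k/\|z_k\|_0$ satisfies $f^\infty(u)=p(u)$ and $u\in N_{\mathcal C_f}(p)$. Thus $(f^\infty(u),u)$ is a nonzero element of the recession cone $E_f^\infty$ on which the corresponding epigraph objective vanishes, i.e. $\ell_{a,b}(f^\infty(u),u)=0$ for every $a>0$ and $b=-ap$.
   Context: $E_f=\{(t,z)\in\mathbb{R}\times X: t\ge f(z)\}$; $\ell_{a,b}(t,z)=at+b(z)$. $f^*(p)=\sup_{z\in X}\{p(z)-f(z)\}$ is the Fenchel conjugate, $\operatorname{dom} f^*=\{p\in X^*: f^*(p)<+\infty\}$; $\partial f(z)=\{p\in X^*: f(y)\ge f(z)+p(y-z)\ \forall y\in X\}$, $\operatorname{ran}\partial f=\bigcup_{z\in X}\partial f(z)$. The recession function is $f^\infty(w)=\lim_{\lambda\to\infty}\frac{f(z+\lambda w)-f(z)}{\lambda}\in\mathbb{R}\cup\{+\infty\}$ (independent of $z$). $\mathcal C_f=\overline{\operatorname{dom} f^*}$ and, for $p\in\mathcal C_f$, $N_{\mathcal C_f}(p)=\{w\in X:\widetilde p(w)\le p(w)\ \text{for every }\widetilde p\in\mathcal C_f\}$. For a nonempty closed convex set $C$,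 $C^\infty=\{d: x+\lambda d\in C\ \forall x\in C,\ \forall\lambda\ge0\}$. *)

(* Defs.v *)
From HB Require Import structures.
From mathcomp Require Import all_boot all_order all_algebra.
From mathcomp Require Import all_classical all_reals all_analysis.
From mathcomp Require Import ring lra.
Import Order.TTheory GRing.Theory Num.Theory.
Import numFieldNormedType.Exports.

Set Implicit Arguments.
Unset Strict Implicit.
Unset Printing Implicit Defensive.

Local Open Scope classical_set_scope.
Local Open Scope ring_scope.

#[short(type="finNormedModType")]
HB.structure Definition FinNormedModule (R : realType) :=
  {V of NormedModule R V & Vector R V}.

Section ConvexAnalysis.
Context {R : realType} {X : finNormedModType R}.
Implicit Types (f : X -> R) (p q : 'Hom(X, R^o)) (z w : X).

Definition dual_norm q : \bar R :=
  ereal_sup [set `|q x|%:E | x in [set x : X | `|x| <= 1]].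

(* 'Hom(X, R^o) has no canonical topology instance: this is the closure for the
   metric of the dual norm. *)
Definition dual_closure (A : set 'Hom(X, R^o)) : set 'Hom(X, R^o) :=
  [set q | forall e : R, 0 < e -> exists2 r, A r & (dual_norm (r - q)%R < e%:E)%E].

Definition fenchel_conjugate f p : \bar R :=
  ereal_sup [set (p z - f z)%:E | z in [set: X]].

Definition conjugate_domain f : set 'Hom(X, R^o) :=
  [set p | (fenchel_conjugate f p < +oo)%E].

Definition subdifferential f z : set 'Hom(X, R^o) :=
  [set p | forall y, f y >= f z + p (y - z)].

Definition subdifferential_range f : set 'Hom(X, R^o) :=
  \bigcup_(z in [set: X]) subdifferential f z.

Definition difference_quotient f z w (l : R) : R := (f (z + l *: w) - f z) / l.

(* The base point is 0; for convex f the limit exists in \bar R and is the same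
   at every base point, by recession_function_cvg below. *)
Definition recession_function f w : \bar R :=
  lim ((difference_quotient f 0 w l)%:E @[l --> +oo]).

Definition conjugate_domain_closure f : set 'Hom(X, R^o) :=
  dual_closure (conjugate_domain f).

Definition normal_cone (C : set 'Hom(X, R^o)) p : set X :=
  [set w | forall q, C q -> q w <= p w].

Definition epigraph f : set (R^o * X)%type := [set x | x.1 >= f x.2].

Definition epigraph_objective (a : R) (b : 'Hom(X, R^o)) (x : R^o * X) : R :=
  a * x.1 + b x.2.

Definition recession_cone (V : lmodType R) (C : set V) : set V :=
  [set d | forall x (l : R), C x -> 0 <= l -> C (x + l *: d)].

Lemma convex_functionE f : convex_function [set: X] f ->
  forall x y (t : R), 0 <= t <= 1 ->
  f (t *: x + (1 - t) *: y) <= t * f x + (1 - t) * f y.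
Proof.
move=> cf x y t t01.
by have /(_ x y) := cf (Itv01 (andP t01).1 (andP t01).2); rewrite !in_setT; exact.
Qed.

Lemma difference_quotient_nd f z w : convex_function [set: X] f ->
  forall l m : R, 0 < l -> l <= m ->
  difference_quotient f z w l <= difference_quotient f z w m.
Proof.
move=> /convex_functionE cf l m l0 lm.
have m0 : 0 < m by exact: lt_le_trans lm.
rewrite /difference_quotient ler_pdivrMr// mulrAC ler_pdivlMr//.
have t01 : 0 <= l / m <= 1.
  by rewrite divr_ge0 ?(ltW l0) ?(ltW m0)//= ler_pdivrMr// mul1r.
have := cf (z + m *: w) z _ t01.
have -> : (l / m) *: (z + m *: w) + (1 - l / m) *: z = z + l *: w.
  by rewrite scalerDr scalerA divfK ?gt_eqF// addrAC -scalerDl subrKC scale1r.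
rewrite -subr_ge0 => H.
rewrite -subr_ge0.
have -> : (f (z + m *: w) - f z) * l - (f (z + l *: w) - f z) * m =
  (l / m * f (z + m *: w) + (1 - l / m) * f z - f (z + l *: w)) * m.
  by field; rewrite gt_eqF.
by rewrite mulr_ge0// ltW.
Qed.

Lemma difference_quotient_le f z y w (s : R) : convex_function [set: X] f ->
  (forall l, 1 <= l -> difference_quotient f y w l <= s) ->
  forall l, 0 < l -> difference_quotient f z w l <= s.
Proof.
move=> /convex_functionE cf ys l l0.
rewrite /difference_quotient ler_pdivrMr// lerBlDr.
set a := z + l *: w; set v := y - z.
set B := `|f y - f z + f (a - v) - f a|.
apply/ler_addgt0Pr => e e0.
have B0 : 0 <= B by exact: normr_ge0.
pose t := Num.min (Num.min 1 l) (e / (B + 1)).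
have t0 : 0 < t by rewrite !lt_min ltr01 l0 divr_gt0// ltr_wpDl.
have t1 : t <= 1 by rewrite /t !ge_min lexx.
have tl : t <= l by rewrite /t !ge_min lexx orbT.
have te : t * B <= e.
  have : t <= e / (B + 1) by rewrite /t !ge_min lexx !orbT.
  rewrite ler_pdivlMr ?ltr_wpDl//; apply: le_trans.
  by rewrite ler_wpM2l ?(ltW t0)// lerDl.
have lt1 : 1 <= l / t by rewrite ler_pdivlMr// mul1r.
have H1 : f (y + (l / t) *: w) <= f y + s * (l / t).
  have := ys _ lt1.
  by rewrite /difference_quotient ler_pdivrMr ?divr_gt0// lerBlDl.
have t01 : 0 <= t <= 1 by rewrite (ltW t0).
have := cf (y + (l / t) *: w) z _ t01.
have -> : t *: (y + (l / t) *: w) + (1 - t) *: z = a + t *: v.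
  rewrite /a /v scalerDr scalerA mulrCA divff ?gt_eqF// mulr1.
  rewrite scalerBl scale1r scalerBr.
  by rewrite [t *: y + _]addrC addrACA [l *: w + z]addrC.
move=> H2.
have p1t : 0 < 1 + t by rewrite addr_gt0.
have r01 : 0 <= (1 + t)^-1 <= 1.
  by rewrite invr_ge0 (ltW p1t)/= invf_le1// lerDl ltW.
have := cf (a + t *: v) (a - v) _ r01.
have t10 : 1 + t != 0 by rewrite gt_eqF.
have -> : (1 + t)^-1 *: (a + t *: v) + (1 - (1 + t)^-1) *: (a - v) = a.
  have -> : 1 - (1 + t)^-1 = t * (1 + t)^-1 by field.
  rewrite [_ *: (a + _)]scalerDr [_ *: (a - v)]scalerBr scalerA addrACA.
  rewrite -scalerDl [(1 + t)^-1 * t]mulrC subrr addr0.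
  have -> : (1 + t)^-1 + t * (1 + t)^-1 = 1 by field.
  exact: scale1r.
move=> H3.
have H4 : (1 + t) * f a <= f (a + t *: v) + t * f (a - v).
  have -> : f (a + t *: v) + t * f (a - v) = (1 + t) *
    ((1 + t)^-1 * f (a + t *: v) + (1 - (1 + t)^-1) * f (a - v)) by field.
  by rewrite ler_pM2l.
have H5 : t * (f y + s * (l / t)) = t * f y + s * l by field; rewrite gt_eqF.
have H6 : t * f (y + l / t *: w) <= t * f y + s * l.
  by rewrite -H5 ler_wpM2l// ltW.
have H7 : t * (f y - f z + f (a - v) - f a) <= e.
  by apply: le_trans te; rewrite ler_wpM2l ?(ltW t0)// ler_norm.
lra.
Qed.

Let slope f z w (l : R) := (difference_quotient f z w (Num.max 1 l))%:E.

Let slope_sup f z w : convex_function [set: X] f ->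
  (difference_quotient f z w l)%:E @[l --> +oo] -->
  ereal_sup (range (slope f z w)).
Proof.
move=> cf.
have nd : nondecreasing_fun (slope f z w).
  move=> l m lm; rewrite lee_fin; apply: difference_quotient_nd => //.
    by rewrite lt_max ltr01.
  by rewrite ge_max le_max lexx/= le_max lm orbT.
apply: cvg_trans (nondecreasing_cvge nd).
apply: near_eq_cvg; near=> l.
rewrite /slope (max_idPr _)//; near: l; exact: nbhs_pinfty_ge.
Unshelve. all: by end_near. Qed.

Let slope_sup_le f z y w : convex_function [set: X] f ->
  (ereal_sup (range (slope f z w)) <= ereal_sup (range (slope f y w)))%E.
Proof.
move=> cf; apply: ge_ereal_sup => _ [l _ <-].
have ub m : 1 <= m ->
    ((difference_quotient f y w m)%:E <= ereal_sup (range (slope f y w)))%E.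
  by move=> m1; apply: ereal_sup_ubound; exists m => //; rewrite /slope (max_idPr _).
move: ub; case: ereal_sup => [s| |] ub.
- rewrite lee_fin; apply: (@difference_quotient_le f z y w s cf _ (Num.max 1 l)) => [m m1|].
    by rewrite -lee_fin ub.
  by rewrite lt_max ltr01.
- by rewrite leey.
- by have := ub 1 (lexx _).
Qed.

Lemma recession_function_cvg f z w : convex_function [set: X] f ->
  (difference_quotient f z w l)%:E @[l --> +oo] --> recession_function f w.
Proof.
move=> cf; rewrite /recession_function (cvg_lim _ (@slope_sup f 0 w cf))//.
suff -> : ereal_sup (range (slope f 0 w)) = ereal_sup (range (slope f z w)).
  exact: slope_sup.
by apply/eqP; rewrite eq_le !slope_sup_le.
Qed.

End ConvexAnalysis.

(* Main.v *)
Require Import Defs.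
From HB Require Import structures.
From mathcomp Require Import all_boot all_order all_algebra.
From mathcomp Require Import all_classical all_reals all_analysis.
From mathcomp Require Import ring lra.
Import Order.TTheory GRing.Theory Num.Theory.
Import numFieldNormedType.Exports.

Local Open Scope classical_set_scope.
Local Open Scope ring_scope.

(* Set g = f - p, a finite convex function on a finite-dimensional space, hence
   continuous, with unattained infimum - f^*(p).  A cluster point of the z_k
   along a bounded subset of indices would be a minimizer of g, so |z_k| tends
   to infinity.  For l >= 0 and k large, l z_k / |z_k| lies between 0 and z_k,
   where convexity bounds g by a convex combination of g 0 and g z_k whose
   weight at z_k tends to 0; at a cluster point u this gives
   g (l u) <= g 0, i.e. f^oo(u) <= p u.  Conversely q <= f^oo pointwise for every
   q in dom f^*, by Fenchel's inequality along the ray.  Hence f^oo(u) = p u and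
   q u <= p u on dom f^*, which passes to the closure. *)

(** * Compactness of balls and continuity of convex functions in finite dimension *)

Section FiniteDimension.
Context {R : realType} {X : finNormedModType R}.

Let n := \dim {: X}.
Let e := vbasis {: X}.

(** Coordinates in a basis transfer compactness from row vectors, which carry the sup norm, to [X]
    with its own norm. *)
Let vec (c : 'rV[R]_n) : X := \sum_(i < n) c ord0 i *: e`_i.
Let row (x : X) : 'rV[R]_n := \row_i coord e i x.

Let rowK : cancel row vec.
Proof.
move=> x; rewrite [RHS](coord_vbasis (memvf x)).
by apply: eq_bigr => i _; rewrite mxE.
Qed.

Let vecK : cancel vec row.
Proof.
move=> c; apply/rowP => i; rewrite mxE coord_sum_free//.
exact: basis_free (vbasisP _).
Qed.

Let vecZ (a : R) c : vec (a *: c) = a *: vec c.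
Proof.
by rewrite scaler_sumr; apply: eq_bigr => i _; rewrite mxE scalerA.
Qed.

Let vec0 : vec 0 = 0.
Proof. by rewrite -(scale0r 0) vecZ scale0r. Qed.

Let continuous_vec : continuous vec.
Proof.
apply: continuous_big => [|i _ c]; first exact: add_continuous.
apply: (cvgZr_tmp (F := nbhs c)); exact: coord_continuous.
Qed.

Let continuous_norm_vec : continuous (fun c => `|vec c|).
Proof.
move=> c; apply: continuous_comp; first exact: continuous_vec.
exact: norm_continuous.
Qed.

Let le_row_coord (c : 'rV[R]_n) i : `|c ord0 i| <= `|c|.
Proof.
rewrite [leRHS]/Num.norm /= mx_normrE.
exact: (le_bigmax _ (fun x => `|c x.1 x.2|) (ord0, i)).
Qed.

(** Half of the equivalence of norms: [vec] is injective, so [|vec c|] has a positive minimum on the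
    compact unit sphere, and its inverse serves as [K] by homogeneity. *)
Let row_bound : exists2 K : R, 0 < K & forall x, `|row x| <= K * `|x|.
Proof.
pose S := [set c : 'rV[R]_n | `|c| = 1].
have cS : compact S.
  apply: bounded_closed_compact.
    by exists 1; split => // M M1 c /= ->; exact: ltW.
  apply: (preimage_closed _ (@closed_eq R 1)) => c _; exact: norm_continuous.
(* If the sphere is empty, every [row x] is 0 and any constant works. *)
have [S0|S0] := pselect (S !=set0); last first.
  exists 1 => // x; rewrite mul1r; have [->|x0] := eqVneq (row x) 0.
    by rewrite normr0.
  case: S0; exists (`|row x|^-1 *: row x) => /=.
  by rewrite /S/= normrZ normfV normr_id mulVf// normr_eq0.
have [|c] := @EVT_min_rV R n (fun c => `|vec c|) S S0 cS.
  by apply: continuous_subspaceT => c; exact: continuous_norm_vec.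
rewrite inE => c1 cmin.
have vc0 : 0 < `|vec c|.
  rewrite normr_gt0; apply/eqP => /(congr1 row); rewrite vecK => c0.
  move: c1; rewrite /S/= c0 -vec0 vecK normr0 => /eqP.
  by rewrite eq_sym oner_eq0.
exists (`|vec c|^-1); first by rewrite invr_gt0.
move=> x; rewrite mulrC ler_pdivlMr//; have [->|x0] := eqVneq (row x) 0.
  by rewrite normr0 mul0r.
have r0 : 0 < `|row x| by rewrite normr_gt0.
have := cmin (`|row x|^-1 *: row x).
rewrite inE /S/= normrZ normfV normr_id mulVf ?gt_eqF// => /(_ erefl).
by rewrite vecZ rowK normrZ normfV normr_id mulrC ler_pdivlMr// mulrC.
Qed.

Lemma compact_closed_ball0 (M : R) : compact [set x : X | `|x| <= M].
Proof.
have -> : [set x : X | `|x| <= M] = vec @` [set c | `|vec c| <= M].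
  apply/seteqP; split => [x xM|_ [c cM <-]//].
  by exists (row x); rewrite /= rowK.
apply: continuous_compact.
  by apply: continuous_subspaceT => c; exact: continuous_vec.
apply: bounded_closed_compact.
  have [K K0 rK] := row_bound.
  exists (K * M); split => [|N KMN c /= cM]; first exact: num_real.
  rewrite -[c]vecK (le_trans (rK _))// (le_trans _ (ltW KMN))//.
  by rewrite ler_pM2l.
apply: (preimage_closed _ (@closed_le R M)) => c _.
exact: continuous_norm_vec.
Qed.

Lemma convex_function_bounded_near (f : X -> R) (z : X) :
  convex_function [set: X] f ->
  exists2 d : R, 0 < d & exists B : R, forall h, `|h| <= d -> f (z + h) <= B.
Proof.
move=> /convex_functionE cf.
(* Halving splits one coordinate off at the cost of doubling the radius. *)
have H (s : seq 'I_n) (M : R) : exists B, forall c : 'rV[R]_n, `|c| <= M ->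
    f (z + \sum_(i <- s) c ord0 i *: e`_i) <= B.
  elim: s M => [|i s IH] M.
    by exists (f z) => c _; rewrite big_nil addr0.
  have [B HB] := IH (2 * M).
  (* The doubled coordinate lies in [-2M, 2M], so its point is on the segment from [z - v] to
     [z + v], where the two end values bound [f]. *)
  pose v := (2 * M) *: e`_i.
  exists (2^-1 * (`|f (z + v)| + `|f (z - v)|) + 2^-1 * B) => c cM.
  have i2 : 1 - 2^-1 = 2^-1 :> R by field.
  have h2 : 0 <= (2^-1 : R) <= 1 by apply/andP; split; lra.
  have half2 (x : X) : 2^-1 *: (2 *: x) = x.
    by rewrite scalerA mulVf ?scale1r// pnatr_eq0.
  rewrite big_cons; set w := \sum_(_ <- _) _.
  have := cf (z + (2 * c ord0 i) *: e`_i) (z + 2 *: w) _ h2.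
  have -> : 2^-1 *: (z + (2 * c ord0 i) *: e`_i) + (1 - 2^-1) *: (z + 2 *: w) =
      z + (c ord0 i *: e`_i + w).
    rewrite i2 -scalerA -scalerDr addrACA -scalerDr -mulr2n -[z *+ 2]scaler_nat.
    by rewrite -scalerDr half2.
  rewrite i2 => /le_trans; apply.
  apply: lerD; rewrite ler_pM2l ?invr_gt0//; last first.
    have := HB (2 *: c); rewrite normrZ ger0_norm// ler_pM2l// => /(_ cM).
    rewrite /w scaler_sumr; congr (f (z + _) <= _).
    by apply: eq_bigr => j _; rewrite mxE scalerA.
  have ciM : `|c ord0 i| <= M by exact: le_trans (le_row_coord _ _) cM.
  have M0 : 0 <= M by exact: le_trans ciM.
  (* The weight [t] below divides by [M], so [M = 0] is treated apart. *)
  have [M00|M_neq0] := eqVneq M 0.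
    move: ciM; rewrite M00 normr_le0 => /eqP ->.
    rewrite /v M00 mulr0 scale0r addr0 subr0.
    by have := ler_norm (f z); have := normr_ge0 (f z); lra.
  have {M_neq0 M0}M0 : 0 < M by rewrite lt_def M_neq0.
  pose t := 2^-1 * (1 + c ord0 i / M).
  have /andP[l1 l2] : -1 <= c ord0 i / M <= 1.
    by rewrite -ler_norml normrM normfV (gtr0_norm M0) ler_pdivrMr// mul1r.
  have t01 : 0 <= t <= 1 by rewrite /t; apply/andP; split; lra.
  have := cf (z + v) (z - v) _ t01.
  have -> : t *: (z + v) + (1 - t) *: (z - v) = z + (2 * c ord0 i) *: e`_i.
    rewrite !scalerDr addrACA -scalerDl [t + _]addrC subrK scale1r; congr (_ + _).
    rewrite scalerN -scalerBl /v scalerA; congr (_ *: _).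
    by rewrite /t; field; rewrite gt_eqF.
  move=> /le_trans; apply; move: t01 => /andP[t0 t1].
  have := ler_norm (f (z + v)); have := ler_norm (f (z - v)).
  have := normr_ge0 (f (z + v)); have := normr_ge0 (f (z - v)).
  by nra.
have [K K0 rK] := row_bound.
have [B HB] := H (index_enum 'I_n) 1.
exists K^-1; first by rewrite invr_gt0.
exists B => h hK; rewrite -[h]rowK; apply: HB.
by rewrite (le_trans (rK _))// mulrC -ler_pdivlMr// mul1r.
Qed.

(** A local upper bound suffices: shrinking towards [z] bounds [f] from above by [f z + eps], and
    reflection through [z] turns this into a lower bound. *)
Lemma convex_function_continuous (f : X -> R) :
  convex_function [set: X] f -> continuous f.
Proof.
move=> cf z; have [d d0 [B HB]] := convex_function_bounded_near f z cf.
move: cf => /convex_functionE cf.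
have Bz : f z <= B by have := HB 0; rewrite normr0 addr0; apply; exact: ltW.
apply/cvgrPdist_le => eps eps0.
(* The 1 added to the denominator keeps it positive when [B = f z]. *)
pose t := Num.min 1 (eps / (B - f z + 1)).
have D0 : 0 < B - f z + 1 by lra.
have t0 : 0 < t by rewrite lt_min ltr01 divr_gt0.
have t01 : 0 <= t <= 1 by rewrite (ltW t0) ge_min lexx.
have tB : t * (B - f z) <= eps.
  have : t <= eps / (B - f z + 1) by rewrite ge_min lexx orbT.
  rewrite ler_pdivlMr//; nra.
have up h : `|h| <= t * d -> f (z + h) <= f z + eps.
  move=> htd; have := cf (z + t^-1 *: h) z _ t01.
  have -> : t *: (z + t^-1 *: h) + (1 - t) *: z = z + h.
    rewrite scalerDr scalerA divff ?gt_eqF// scale1r addrAC -scalerDl.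
    by rewrite [t + _]addrC subrK scale1r.
  have : f (z + t^-1 *: h) <= B.
    by apply: HB; rewrite normrZ gtr0_norm ?invr_gt0// mulrC ler_pdivrMr// mulrC.
  move: t01 => /andP[_ t1]; nra.
near=> y.
have zy : `|y - z| <= t * d.
  rewrite distrC; near: y; apply: cvgr_dist_le => //; exact: mulr_gt0.
rewrite ler_distl.
have := up _ zy; rewrite addrC subrK => Hy.
have := up (z - y); rewrite distrC => /(_ zy) Hy'.
(* [z] is the midpoint of [y] and its reflection [z + (z - y)]. *)
have := cf y (z + (z - y)) 2^-1.
have -> : 1 - 2^-1 = 2^-1 :> R by field.
rewrite -scalerDr addrCA [y + _]addrC subrK -mulr2n -[z *+ 2]scaler_nat scalerA.
rewrite mulVf ?pnatr_eq0// scale1r => Hm.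
have {}Hm : f z <= 2^-1 * f y + 2^-1 * f (z + (z - y)).
  by apply: Hm; apply/andP; split; lra.
apply/andP; split; lra.
Unshelve. all: by end_near. Qed.
End FiniteDimension.

(** * Minimizing sequences and the cluster points of their directions *)

Section MinimizingSequences.
Context {R : realType} {X : finNormedModType R}.
Implicit Types (f : X -> R) (p : 'Hom(X, R^o)).

Lemma convex_functionB_linear f p :
  convex_function [set: X] f -> convex_function [set: X] (fun x => f x - p x).
Proof.
move=> cf t x y xT yT; have := cf t x y xT yT.
rewrite !convRE /conv/= linearD !linearZ/=.
by rewrite /unstable.onem; rewrite /GRing.scale/=; lra.
Qed.

Lemma conjugate_domainP f p : conjugate_domain f p ->
  exists2 S : R, fenchel_conjugate f p = S%:E & forall x, p x - f x <= S.
Proof.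
rewrite /conjugate_domain/= => fin.
have ub x : ((p x - f x)%:E <= fenchel_conjugate f p)%E.
  by apply: ereal_sup_ubound; exists x.
case: (fenchel_conjugate f p) fin ub => [S| |] // _ ub.
  by exists S => // x; rewrite -lee_fin.
by have := ub 0.
Qed.

Lemma cvg_norm_minimizing f (s : R) (z : nat -> X) :
  continuous f -> (forall y, s < f y) -> f (z k) @[k --> \oo] --> s ->
  `|z k| @[k --> \oo] --> +oo.
Proof.
move=> cf sf fz; apply/cvgryPgt => M; apply: contrapT => nM.
(* Tails restricted to the indices with [|z k| <= M]; the filter is proper because such indices
   recur beyond every rank. *)
pose G := within [set k | `|z k| <= M] \oo.
have GF : ProperFilter G.
  apply: Build_ProperFilter_ex => P GP; apply: contrapT => nP; apply: nM.
  move: GP; rewrite /G/within/=; apply: filterS => k zP; rewrite ltNge; apply/negP => zkM.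
  by apply: nP; exists k; exact: zP.
have GM : (z @ G) [set x | `|x| <= M] by exact: withinT.
have [w [_ clw]] := compact_closed_ball0 M (z @ G) _ GM.
(* The midpoint separates the values along the sequence, eventually below it, from those of [f] near
   [w], above it. *)
have sw : s < (s + f w) / 2 by have := sf w; lra.
have ws : (s + f w) / 2 < f w by have := sf w; lra.
have A : (z @ G) [set x | f x < (s + f w) / 2].
  by apply: cvg_within; exact: (cvgr_lt _ fz _ sw).
have [v [/= v1 v2]] := clw _ _ A (cvgr_gt _ (cf w) _ ws).
by move: (lt_trans v1 v2); rewrite ltxx.
Qed.

Section Cluster.
Variables (f : X -> R) (z : nat -> X) (u : X).
Hypotheses (f_convex : convex_function [set: X] f).
Hypotheses (z_infty : `|z k| @[k --> \oo] --> +oo).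
Hypothesis clu : cluster ((`|z k|^-1 *: z k) @[k --> \oo]) u.

(** Eventually [z k] is nonzero, so the normalized sequence stays on the unit sphere, which is
    closed. *)
Lemma cluster_normalized_norm : `|u| = 1.
Proof.
apply/eqP/negPn/negP => u1.
have A : \forall k \near \oo, `| `|z k|^-1 *: z k| = 1.
  have /cvgryPgt/(_ 0) := z_infty; apply: filterS => k zk0 /=.
  by rewrite normrZ normfV normr_id mulVf// gt_eqF.
have B : nbhs u [set v | `|v| != 1].
  have := @norm_continuous _ X u.
  by move=> /(_ _ (open_nbhs_nbhs (conj (@open_neq R 1) u1))).
by have [v [/= ->]] := clu [set v | `|v| = 1] _ A B; rewrite eqxx.
Qed.

Lemma cluster_direction_le (B l : R) : 0 <= l ->
  (\forall k \near \oo, f (z k) <= B) -> f (l *: u) <= f 0.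
Proof.
move=> l0 fB; apply/ler_addgt0Pr => eps eps0; rewrite leNgt; apply/negP => flu.
have N : nbhs u [set v | f 0 + eps < f (l *: v)].
  have cfl : {for u, continuous (f \o ( *:%R l))}.
    apply: continuous_comp; first exact: scaler_continuous.
    exact: convex_function_continuous.
  exact: (cvgr_gt _ cfl _ flu).
(* The first bound puts the weight [t = l / |z k|] in [0, 1]; the second makes [t * (B - f 0)] at
   most [eps]. *)
pose T := Num.max (l + 1) (l * (`|B - f 0| + 1) / eps).
have A : \forall k \near \oo, f (l *: (`|z k|^-1 *: z k)) <= f 0 + eps.
  have /cvgryPgt/(_ T) := z_infty; apply: filterS2 fB => k fkB zT /=.
  have zl : l + 1 < `|z k| by apply: le_lt_trans zT; rewrite le_max lexx.
  have z0 : 0 < `|z k| by lra.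
  have : l * (`|B - f 0| + 1) / eps < `|z k|.
    by apply: le_lt_trans zT; rewrite le_max lexx orbT.
  rewrite ltr_pdivrMr// => zeps.
  set t := l / `|z k|.
  have t01 : 0 <= t <= 1 by rewrite divr_ge0// ler_pdivrMr// mul1r; lra.
  have tz : t * `|z k| = l by rewrite divfK// gt_eqF.
  have := convex_functionE f_convex (z k) 0 t01.
  rewrite scaler0 addr0 scalerA => /le_trans; apply.
  have teps : t * (`|B - f 0| + 1) <= eps.
    by rewrite /t mulrAC ler_pdivrMr// [eps * _]mulrC ltW.
  have := ler_norm (B - f 0); move: t01 => /andP[t0 t1]; nra.
by have [v [/= v1]] := clu [set v | f (l *: v) <= f 0 + eps] _ A N; rewrite ltNge v1.
Qed.

End Cluster.
End MinimizingSequences.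

(** * Recession function, conjugate domain and recession cone of the epigraph *)

Section Recession.
Context {R : realType} {X : finNormedModType R}.
Implicit Types (f : X -> R) (p q : 'Hom(X, R^o)).

(** Difference quotients are nondecreasing in the step, so each is below their limit. *)
Lemma le_recession_function f w x (l : R) : convex_function [set: X] f ->
  0 < l -> ((difference_quotient f x w l)%:E <= recession_function f w)%E.
Proof.
move=> cf l0; have h := @recession_function_cvg R X f x w cf.
rewrite -(cvg_lim _ h)//; apply: lime_ge; first by apply/cvg_ex; eexists; exact: h.
near=> m; have lm : l <= m by near: m; exact/nbhs_pinfty_ge/num_real.
by rewrite lee_fin; exact: difference_quotient_nd.
Unshelve. all: by end_near. Qed.

Lemma recession_function_le f w (s : \bar R) : convex_function [set: X] f ->
  (forall l : R, 0 < l -> ((difference_quotient f 0 w l)%:E <= s)%E) ->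
  (recession_function f w <= s)%E.
Proof.
move=> cf fs; have h := @recession_function_cvg R X f 0 w cf.
rewrite -(cvg_lim _ h)//; apply: lime_le; first by apply/cvg_ex; eexists; exact: h.
near=> m; apply: fs; near: m; exact/nbhs_pinfty_gt/num_real.
Unshelve. all: by end_near. Qed.

Lemma conjugate_domain_le_recession f q w : convex_function [set: X] f ->
  conjugate_domain f q -> ((q w)%:E <= recession_function f w)%E.
Proof.
move=> cf /conjugate_domainP[S _ qS].
(* Fenchel's inequality at [l *: w], divided by [l]; the error term vanishes as [l] grows. *)
have h l : 0 < l -> ((q w - (S + f 0) / l)%:E <= recession_function f w)%E.
  move=> l0; apply: le_trans (le_recession_function _ _ 0 _ cf l0).
  rewrite lee_fin /difference_quotient add0r ler_pdivlMr// mulrBl divfK ?gt_eqF//.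
  have := qS (l *: w); rewrite linearZ/= /GRing.scale/=; lra.
move: h; case: (recession_function f w) => [r| |] h; last 2 first.
- exact: leey.
- by have := h 1 ltr01; rewrite leeNy_eq.
rewrite lee_fin; apply/ler_addgt0Pr => e e0.
pose l := (`|S + f 0| + 1) / e.
have S0 : 0 < `|S + f 0| + 1 by rewrite ltr_wpDl.
have := h _ (divr_gt0 S0 e0); rewrite lee_fin.
have : (S + f 0) / ((`|S + f 0| + 1) / e) <= e.
  rewrite ler_pdivrMr ?divr_gt0// mulrC divfK ?gt_eqF//.
  by rewrite (le_trans (ler_norm _))// lerDl.
lra.
Qed.

(** Testing the dual norm at [w / |w|] shows that an approximant within [e / |w|] of [q] changes the
    value at [w] by less than [e]. *)
Lemma normal_cone_dual_closure (A : set 'Hom(X, R^o)) p w :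
  normal_cone A p w -> normal_cone (dual_closure A) p w.
Proof.
move=> Aw q qA; have [->|w0] := eqVneq w 0; first by rewrite !linear0.
have nw : 0 < `|w| by rewrite normr_gt0.
apply/ler_addgt0Pr => e e0.
have [r Ar] := qA _ (divr_gt0 e0 nw).
have : ((`|(r - q)%R (`|w|^-1 *: w)|)%:E <= dual_norm (r - q)%R)%E.
  apply: ereal_sup_ubound; exists (`|w|^-1 *: w) => //=.
  by rewrite normrZ normfV normr_id mulVf// gt_eqF.
move=> /le_lt_trans/[apply]; rewrite lte_fin linearZ/= normrZ normfV normr_id.
rewrite mulrC ltr_pM2r ?invr_gt0// ltr_norml => /andP[+ _].
rewrite add_lfunE opp_lfunE; have := Aw _ Ar; lra.
Qed.

(** The recession value bounds the slope along [w] from every base point, so moving by [(s, w)]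
    never leaves the epigraph. *)
Lemma recession_cone_epigraph f w (s : R) : convex_function [set: X] f ->
  (recession_function f w <= s%:E)%E -> recession_cone (epigraph f) (s, w).
Proof.
move=> cf fs [t x] l/= tx; rewrite le_eqVlt => /predU1P[<-|l0].
  by rewrite !scale0r !addr0.
have := le_trans (le_recession_function _ w x _ cf l0) fs.
rewrite lee_fin /difference_quotient ler_pdivrMr// /epigraph/=.
rewrite /GRing.scale/=; move: tx; rewrite /epigraph/=; lra.
Qed.

End Recession.

Theorem theorem3p4 (R : realType) (X : finNormedModType R)
    (X_neq0 : (0 < \dim {: X})%N)
    (f : X -> R) (f_convex : convex_function [set: X] f)
    (p : 'Hom(X, R^o))
    (p_in : (conjugate_domain f `\` subdifferential_range f) p)
    (z : nat -> X)
    (z_min : (f (z k) - p (z k))%:E @[k --> \oo] --> (- fenchel_conjugate f p)%E) :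
  (`|z k| @[k --> \oo] --> +oo) /\
  (forall u : X, cluster ((`|z k|^-1 *: z k) @[k --> \oo]) u ->
     [/\ recession_function f u = (p u)%:E,
         normal_cone (conjugate_domain_closure f) p u,
         (fine (recession_function f u), u) <> 0 :> (R^o * X)%type,
         recession_cone (epigraph f) (fine (recession_function f u), u) &
         forall (a : R) (b : 'Hom(X, R^o)), 0 < a -> b = - (a *: p) ->
           epigraph_objective a b (fine (recession_function f u), u) = 0]).
Proof.
case: p_in => p_dom p_nran.
have [S fS pS] := conjugate_domainP _ _ p_dom.
pose g x := f x - p x.
have cg : convex_function [set: X] g by exact: convex_functionB_linear.
have gz : g (z k) @[k --> \oo] --> - S.
  by move: z_min; rewrite fS => /fine_cvg.
(* A point with [g y <= - S] would minimize [g], making [p] a subgradient of [f] at [y]. *)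
have gS y : - S < g y.
  rewrite ltNge; apply/negP => gy; apply: p_nran; exists y => // x.
  have := pS x; move: gy; rewrite /g linearB/=; lra.
have z_infty : `|z k| @[k --> \oo] --> +oo.
  exact: (cvg_norm_minimizing g _ _ (convex_function_continuous _ cg) gS gz).
split=> // u clu.
have gu l : 0 <= l -> g (l *: u) <= g 0.
  (* Any bound above the limit [- S] holds eventually along the sequence; [- S + 1] is one. *)
  move=> l0; apply: (cluster_direction_le _ _ _ cg z_infty clu (- S + 1)) => //.
  by apply: (cvgr_le _ gz); lra.
have fu : recession_function f u = (p u)%:E.
  apply/eqP; rewrite eq_le conjugate_domain_le_recession// andbT.
  apply: recession_function_le => // l l0.
  rewrite lee_fin /difference_quotient add0r ler_pdivrMr//.
  have := gu l (ltW l0); rewrite /g linearZ linear0/= /GRing.scale/=; lra.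
rewrite fu; split => //.
- apply: normal_cone_dual_closure => q qf.
  by rewrite -lee_fin -fu conjugate_domain_le_recession.
- case=> _ u0; have := cluster_normalized_norm _ _ z_infty clu.
  by rewrite u0 normr0 => /eqP; rewrite eq_sym oner_eq0.
- by apply: recession_cone_epigraph => //; rewrite fu.
- move=> a b _ ->; rewrite /epigraph_objective/= opp_lfunE scale_lfunE.
  by rewrite /GRing.scale/= addrN.
Qed.
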